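(* Let $0<\alpha<1$, let $a<b$ be real numbers with $a\equiv b \bmod 1$, and let $f$ and $g$ be real functions defined on $\mathbb{N}_a\cap{_{b}\mathbb{N}}$. Then $$\sum_{s=a+1}^{b-1}g(s)\,({^{C}_{b}\nabla^{\alpha}}f)(s)=f(s)\,(\nabla_a^{-(1-\alpha)}g)(s)\Big|_{b}^{a+1}+\sum_{s=a+1}^{b-1}f(s+1)\,(\nabla_a^{\alpha}g)(s+1),$$ where $(\nabla_a^{-(1-\alpha)}g)(a+1)=g(a+1)$.
   Context: For real $a,b$: $\mathbb{N}_a=\{a,a+1,\ldots\}$, ${_{b}\mathbb{N}}=\{b,b-1,\ldots\}$. The notation $F(s)\big|_{b}^{a+1}$ means $F(a+1)-F(b)$; sums run in steps of $1$ and empty sums are $0$. $\rho(t)=t-1$, $\Delta f(t)=f(t+1)-f(t)$, $\nabla f(t)=f(t)-f(t-1)$. Rising function: $t^{\overline{\alpha}}=\Gamma(t+\alpha)/\Gamma(t)$ for $t\notin\{\ldots,-2,-1,0\}$, $0^{\overline{\alpha}}=0$. For $\beta>0$, nabla left and right fractional sums: $$\nabla_a^{-\beta}h(t)=\frac{1}{\Gamma(\beta)}\sum_{s=a+1}^{t}(t-\rho(s))^{\overline{\beta-1}}h(s),\qquad {_{b}\nabla^{-\beta}}h(t)=\frac{1}{\Gamma(\beta)}\sum_{s=t}^{b-1}(s-\rho(t))^{\overline{\beta-1}}h(s).$$ For $0<\alpha<1$: the nabla left Riemann--Liouville fractional difference is $\nabla_a^{\alpha}g(t)=\nabla\big(\nabla_a^{-(1-\alpha)}g\big)(t)$,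 and the nabla right Caputo fractional difference is ${^{C}_{b}\nabla^{\alpha}}f(t)={_{b}\nabla^{-(1-\alpha)}}(-\Delta f)(t)$. *)

(* Defs.v *)
From HB Require Import structures.
From mathcomp Require Import all_boot all_order all_algebra.
From mathcomp Require Import all_classical all_reals all_analysis.
Set Implicit Arguments.
Unset Strict Implicit.
Unset Printing Implicit Defensive.
Import Order.TTheory GRing.Theory Num.Theory.
Import numFieldNormedType.Exports.
Local Open Scope classical_set_scope.
Local Open Scope ring_scope.

(* Functions on a lattice c + Z (or a segment of it) are represented by total
   functions R -> R; every operator below evaluates its argument only at
   points of the lattice on which its mathematical counterpart does. *)

Section FractionalSums.
Variable R : realType.
Implicit Types (F f g h : R -> R) (a b c d s t alpha beta x : R).

Definition euler_integral x : R :=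
  \int[@lebesgue_measure R]_(u in `]0, +oo[) (u `^ (x - 1) * expR (- u)).

(* The Gamma function on the real line: Euler's integral for x > 0, extended
   by Gamma x = Gamma (x + n) / (x (x + 1) ... (x + n - 1)) where n is the
   least natural number with x + n > 0.  At the poles 0, -1, -2, ... the
   denominator vanishes and the value is the junk value 0. *)
Definition Gamma x : R :=
  let n := if 0 < x then 0%N else (Num.truncn (- x)).+1 in
  euler_integral (x + n%:R) / \prod_(k < n) (x + k%:R).

(* Rising function; junk value 0 when t is a negative integer. *)
Definition rising t alpha : R :=
  if t == 0 then 0 else Gamma (t + alpha) / Gamma t.

(* The sum of F over c, c + 1, ..., d, for d - c an integer.  As truncn is 0 on
   negative numbers, the sum is empty when d < c. *)
Definition step_sum c d F : R :=
  \sum_(k < Num.truncn (d - c + 1)) F (c + k%:R).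

Definition rho t : R := t - 1.
Definition Delta f t : R := f (t + 1) - f t.
Definition nabla f t : R := f t - f (t - 1).

Definition nabla_left_sum a beta h t : R :=
  (Gamma beta)^-1 *
  step_sum (a + 1) t (fun s => rising (t - rho s) (beta - 1) * h s).

Definition nabla_right_sum b beta h t : R :=
  (Gamma beta)^-1 *
  step_sum t (b - 1) (fun s => rising (s - rho t) (beta - 1) * h s).

(* Left Riemann-Liouville difference, of order 0 < alpha < 1. *)
Definition nabla_left_RL a alpha g : R -> R :=
  nabla (nabla_left_sum a (1 - alpha) g).

(* Right Caputo difference, of order 0 < alpha < 1. *)
Definition nabla_right_Caputo b alpha f : R -> R :=
  nabla_right_sum b (1 - alpha) (fun s => - Delta f s).

(* F |_b^d *)
Definition eval_between F b d : R := F d - F b.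

End FractionalSums.

(* Main.v *)
(* Put F k = f(a+1+k), L k = (nabla_a^{-(1-alpha)} g)(a+1+k).  Both fractional sums
   have the same kernel w(j), depending only on the lag j, so exchanging the
   order of summation moves the kernel from Delta f onto g and turns the left
   side into - \sum_k L k (F k.+1 - F k); Abel summation then gives the identity.
   The boundary value L 0 = g(a+1) is w(0) = 1, which needs Gamma 1 = 1 and that
   Euler's integral for Gamma (1 - alpha) is neither 0 nor divergent (Rintegral
   would give 0 for a divergent integral). *)
Require Import Defs.
From HB Require Import structures.
From mathcomp Require Import all_boot all_order all_algebra.
From mathcomp Require Import all_classical all_reals all_analysis.
From mathcomp Require Import measurable_realfun ring lra.
Import Order.TTheory GRing.Theory Num.Theory.
Import numFieldNormedType.Exports.
Local Open Scope ring_scope.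

(** * Finiteness and positivity of Euler's integral on []0, 1]] *)

Section EulerIntegral.
Set Implicit Arguments.
Unset Strict Implicit.
Variable R : realType.
Implicit Types (a u x : R).
Local Open Scope classical_set_scope.
Notation mu := (@lebesgue_measure R).

(** Exponentiated, this bounds exp(-u) by e exp(-u^x), the comparison behind [euler_integral_le]. *)
Lemma powR_le1D x u : 0 < x <= 1 -> 0 <= u -> u `^ x <= 1 + u.
Proof.
move=> /andP[x0 x1] u0; have [u1|/ltW u1] := leP u 1.
  apply: (@le_trans _ _ 1); last by rewrite lerDl.
  have <- : 1 `^ x = 1 :> R by rewrite powR1.
  by apply: ge0_ler_powR => //; exact: ltW.
by apply: (@le_trans _ _ u); [exact: ler1_powR | rewrite lerDr].
Qed.

Lemma powR_cvgy x : 0 < x -> u `^ x @[u --> +oo] --> +oo.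
Proof.
move=> x0; apply/cvgryPge => A; near=> u.
apply: (le_trans (ler_norm A)).
have -> : `|A| = (`|A| `^ x^-1) `^ x.
  by rewrite -powRrM mulVf ?gt_eqF// powRr1.
have Au : `|A| `^ x^-1 <= u by near: u; apply: nbhs_pinfty_ge; exact: num_real.
apply: ge0_ler_powR => //; first exact: ltW.
- by rewrite nnegrE powR_ge0.
- by rewrite nnegrE; apply: le_trans Au; exact: powR_ge0.
Unshelve. all: by end_near. Qed.

Lemma is_derive_expRN_powR x u : 0 < x -> 0 < u ->
  is_derive u 1 (fun v : R => - (x^-1 * expR (- (v `^ x))))
    (u `^ (x - 1) * expR (- (u `^ x))).
Proof.
move=> x0 u0.
have uI : u \in `]0, +oo[%R by rewrite in_itv/= u0.
have dp : is_derive u 1 (@powR R ^~ x) (x * u `^ (x - 1)).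
  apply: DeriveDef; first exact: derivable_powR.
  by rewrite -derive1E powR_derive1.
have de : is_derive u 1 (fun v : R => expR (- (v `^ x)))
    (expR (- (u `^ x)) * - (x * u `^ (x - 1))).
  exact: (is_derive1_comp (f := expR) (g := fun v => - (v `^ x))).
apply: is_derive_eq.
by rewrite /GRing.scale/=; field; rewrite gt_eqF.
Qed.

Lemma continuous_gamma_integrand x (p : R -> R) u : 0 < u ->
  {for u, continuous p} ->
  {for u, continuous (fun v => v `^ (x - 1) * expR (- p v))}.
Proof.
move=> u0 cp; apply: continuousM.
  apply: differentiable_continuous; apply/derivable1_diffP.
  by apply: derivable_powR; rewrite in_itv/= u0.
apply: (@continuous_comp _ _ _ (fun v => - p v) expR).
  exact: continuousN.
exact: continuous_expR.
Qed.

(** The exponent [p] is left open to cover both Euler's integrand ([id]) and its dominating function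
    (the power [x]). *)
Lemma measurable_gamma_integrand x (p : R -> R) (D : set R) :
  measurable_fun setT p ->
  measurable_fun D (EFin \o (fun u => u `^ (x - 1) * expR (- p u))).
Proof.
move=> mp; apply: measurable_funTS; apply/measurable_EFinP.
apply: measurable_funM; first exact: measurable_powR.
apply: (@measurableT_comp _ _ _ _ _ _ expR) => //.
exact: measurable_funN.
Qed.

(** The integral equals x^-1 exp(-a^x). The bound does not depend on [a], so it survives a -> 0,
    while [a > 0] keeps away from the singularity at 0. *)
Lemma integral_powR_expRN_powR_le x a : 0 < x -> 0 < a ->
  (\int[mu]_(u in `[a, +oo[) (u `^ (x - 1) * expR (- (u `^ x)))%:E
     <= x^-1%:E)%E.
Proof.
move=> x0 a0.
pose F (v : R) := - (x^-1 * expR (- (v `^ x))).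
have cF u : 0 < u -> {for u, continuous F}.
  move=> u0; apply: differentiable_continuous; apply/derivable1_diffP.
  by have [] := is_derive_expRN_powR x0 u0.
have cf u : 0 < u ->
    {for u, continuous (fun v => v `^ (x - 1) * expR (- (v `^ x)))}.
  move=> u0; apply: continuous_gamma_integrand => //.
  apply: differentiable_continuous; apply/derivable1_diffP.
  by apply: derivable_powR; rewrite in_itv/= u0.
rewrite (@ge0_continuous_FTC2y R _ F a 0).
- rewrite sub0e -EFinN lee_fin opprK ler_piMr//; first by rewrite invr_ge0 ltW.
  by rewrite expR_le1 oppr_le0 powR_ge0.
- by move=> u au; rewrite mulr_ge0 ?powR_ge0 ?expR_ge0.
- apply/continuous_within_itvcyP; split.
    move=> u; rewrite in_itv/= andbT => au; apply: cf.
    exact: lt_trans au.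
  by apply: cvg_at_right_filter; exact: cf.
- rewrite -[0]oppr0 -[in X in _ --> X](mulr0 x^-1); apply: cvgN; apply: cvgMr.
  exact: (cvg_comp _ _ (powR_cvgy x0) (@cvgr_expR R)).
- by move=> u au; have [] := is_derive_expRN_powR x0 (lt_trans a0 au).
- by apply: cvg_at_right_filter; exact: cF.
- move=> u; rewrite in_itv/= andbT => au; rewrite derive1E.
  exact: (@derive_val _ _ _ _ _ _ _ (is_derive_expRN_powR x0 (lt_trans a0 au))).
Qed.

(* [u `^ x <= 1 + u] lets [u `^ (x - 1) * expR (- (u `^ x))], which has an
   elementary bounded primitive, dominate the integrand on each [1/(n+1), +oo[. *)
Lemma euler_integral_le x : 0 < x <= 1 ->
  (\int[mu]_(u in `]0%R, +oo[) (u `^ (x - 1) * expR (- u))%:E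
     <= (expR 1 * x^-1)%:E)%E.
Proof.
move=> x01; have /andP[x0 x1] := x01.
pose f u : \bar R := (u `^ (x - 1) * expR (- u))%:E.
pose D (n : nat) : set R := `[n.+1%:R^-1, +oo[.
have nneg_f u : (0 <= f u)%E by rewrite lee_fin mulr_ge0 ?powR_ge0 ?expR_ge0.
have mf E : measurable_fun E f.
  by apply: (@measurable_gamma_integrand x id); exact: measurable_id.
have mg E : measurable_fun E (EFin \o (fun u => u `^ (x - 1) * expR (- u `^ x))).
  apply: (@measurable_gamma_integrand x (@powR R ^~ x)); exact: measurable_powR.
have -> : `]0, +oo[ = \bigcup_n D n.
  apply/seteqP; split=> u /=; rewrite in_itv/= andbT.
    (* With n the integer part of 1/u, 1/u < n + 1, so u lies in [D n]. *)
    move=> u0; exists (Num.truncn u^-1) => //=.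
    rewrite /D/= in_itv/= andbT -[leRHS]invrK lef_pV2 ?posrE ?invr_gt0//.
    by apply/ltW; exact: truncnS_gt.
  case=> n _; rewrite /D/= in_itv/= andbT; apply: lt_le_trans.
  by rewrite invr_gt0.
have mD n : measurable (D n) by exact: measurable_itv.
have cvg_intD : (\int[mu]_(u in D n) f u)%E @[n --> \oo] -->
    (\int[mu]_(u in \bigcup_n D n) f u)%E.
  apply: ge0_nondecreasing_set_cvg_integral => //; last first.
    by move=> n; exact: mf.
  move=> m n mn; apply/subsetPset => u; rewrite /D/= !in_itv/= !andbT.
  by apply: le_trans; rewrite lef_pV2 ?posrE// ler_nat.
rewrite -(cvg_lim _ cvg_intD)//; apply: lime_le; first exact: cvgP cvg_intD.
near=> n.
apply: (@le_trans _ _ (\int[mu]_(u in D n)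
    ((expR 1)%:E * (u `^ (x - 1) * expR (- (u `^ x)))%:E))%E).
  apply: ge0_le_integral => //.
  - exact: mD.
  - exact: mf.
  - by apply: measurable_funeM; exact: mg.
  - move=> u; rewrite /D/= in_itv/= andbT => nu.
    have u0 : 0 <= u by apply: le_trans nu; rewrite invr_ge0.
    rewrite -EFinM lee_fin mulrCA ler_wpM2l ?powR_ge0// -expRD ler_expR.
    by have := powR_le1D x01 u0; lra.
rewrite ge0_integralZl//=; first last.
- by move=> u _; rewrite lee_fin mulr_ge0 ?powR_ge0 ?expR_ge0.
- exact: mg.
- exact: mD.
rewrite EFinM lee_pmul2l ?lte_fin ?expR_gt0//.
by apply: integral_powR_expRN_powR_le => //; rewrite invr_gt0.
Unshelve. all: by end_near. Qed.

(** Since [fine] sends +oo to 0, the upper bound is needed as well as a positive lower one. The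
    latter comes from []0, 1]], where u^(x-1) >= 1 and exp(-u) >= exp(-1). *)
Lemma Gamma_gt0 x : 0 < x <= 1 -> 0 < Gamma x.
Proof.
move=> x01; have /andP[x0 x1] := x01.
rewrite /Gamma x0 big_ord0 divr1 addr0 /euler_integral /Rintegral.
apply: fine_gt0; rewrite (le_lt_trans (euler_integral_le x01)) ?ltry// andbT.
have mf D : measurable_fun D (EFin \o (fun u => u `^ (x - 1) * expR (- u))).
  by apply: (@measurable_gamma_integrand x id); exact: measurable_id.
have nneg u : (0 <= (u `^ (x - 1) * expR (- u))%:E)%E.
  by rewrite lee_fin mulr_ge0 ?powR_ge0 ?expR_ge0.
apply: (@lt_le_trans _ _ (\int[mu]_(u in `]0%R, 1%R]) (expR (-1))%:E)%E).
  rewrite integral_cst//= lebesgue_measure_itv/= lte_fin ltr01 oppr0 adde0.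
  by rewrite mule1 lte_fin expR_gt0.
apply: (@le_trans _ _ (\int[mu]_(u in `]0%R, 1%R])
    (u `^ (x - 1) * expR (- u))%:E)%E).
  apply: ge0_le_integral => //.
  - exact: mf.
  - move=> u /=; rewrite in_itv/= => u01; have /andP[u0 u1] := u01.
    rewrite lee_fin -[leLHS]mul1r ler_pM ?expR_ge0// ?ler_expR ?lerN2//.
    by rewrite -[leLHS](powRr0 u) ger_powR// subr_le0.
apply: ge0_subset_integral => //; first exact: mf.
by move=> u /=; rewrite !in_itv/= andbT => /andP[].
Qed.

(** At x = 1 the integrand is the exponential density of rate 1, of total mass 1; the endpoint 0 is
    a null set. *)
Lemma Gamma1 : Gamma 1 = 1 :> R.
Proof.
rewrite /Gamma ltr01 big_ord0 divr1 addr0 /euler_integral /Rintegral subrr.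
rewrite -[RHS]/(fine 1%:E) -(@integral_exponential_pdf R 1)//; congr fine.
rewrite [RHS](_ : _ = \int[mu]_(u in `[0%R, +oo[) (expR (- u))%:E)%E; last first.
  rewrite [RHS]integral_mkcond; apply: eq_integral => u _.
  rewrite /exponential_pdf !patchE; case: ifP => // _.
  by rewrite mul1r mulN1r.
rewrite -integral_itv_obnd_cbnd//; last first.
  apply: measurable_funTS; apply/measurable_EFinP.
  by apply: measurableT_comp => //; exact: measurable_funN.
by apply: eq_integral => u _; rewrite powRr0 mul1r.
Qed.

End EulerIntegral.

(** * Convolution form of the fractional sums, and Abel summation *)

Section DiscreteSums.
Set Implicit Arguments.
Unset Strict Implicit.
Variable R : realType.
Implicit Types (a b beta c d t : R) (f g h F : R -> R).

Lemma step_sum_nat c d F n : d - c + 1 = n%:R ->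
  step_sum c d F = \sum_(k < n) F (c + k%:R).
Proof. by rewrite /step_sum => ->; rewrite natrK. Qed.

(** Weight at lag j = t - s, where t - rho(s) = j + 1. For [beta > 0] it is the generalized binomial
    coefficient (j + beta - 1 choose j). *)
Definition nabla_kernel beta (j : nat) : R :=
  (Gamma beta)^-1 * rising j.+1%:R (beta - 1).

(** At lag 0 the rising function is Gamma(beta) / Gamma(1), which cancels the normalising factor. *)
Lemma nabla_kernel0 beta : 0 < beta <= 1 -> nabla_kernel beta 0 = 1.
Proof.
move=> b01; rewrite /nabla_kernel /rising oner_eq0 Gamma1 divr1 addrC subrK.
by rewrite mulVf// gt_eqF// Gamma_gt0.
Qed.

Lemma nabla_left_sum_nat a beta h k :
  nabla_left_sum a beta h (a + 1 + k%:R) =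
  \sum_(i < k.+1) nabla_kernel beta (k - i) * h (a + 1 + i%:R).
Proof.
rewrite /nabla_left_sum (@step_sum_nat _ _ _ k.+1); last first.
  by rewrite -natr1; ring.
rewrite mulr_sumr; apply: eq_bigr => i _; rewrite mulrA.
congr (_ * rising _ _ * _).
rewrite /rho -natr1 natrB; last by rewrite -ltnS.
by ring.
Qed.

(** Because the sum stops at b - 1, an endpoint at distance [m] gives exactly [m] terms. *)
Lemma nabla_right_sum_nat t beta h m :
  nabla_right_sum (t + m%:R) beta h t =
  \sum_(j < m) nabla_kernel beta j * h (t + j%:R).
Proof.
rewrite /nabla_right_sum (@step_sum_nat _ _ _ m); last by ring.
rewrite mulr_sumr; apply: eq_bigr => i _; rewrite mulrA.
congr (_ * rising _ _ * _).
by rewrite /rho -natr1; ring.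
Qed.

(** Both sides sum w(i - k) G(k) D(i) over the triangle k <= i < m; on the left, i = k + j. *)
Lemma sum_convolution_exchange (w G D : nat -> R) m :
  \sum_(k < m) G k * (\sum_(j < m - k) w j * D (k + j)%N) =
  \sum_(i < m) (\sum_(k < i.+1) w (i - k)%N * G k) * D i.
Proof.
transitivity (\sum_(k < m) \sum_(i < m | (k <= i)%N) w (i - k)%N * G k * D i).
  apply: eq_bigr => k _; rewrite mulr_sumr.
  rewrite -(big_mkord xpredT (fun j => G k * (w j * D (k + j)%N))).
  rewrite -(big_mkord (fun i => k <= i)%N (fun i => w (i - k)%N * G k * D i)).
  (* Split the range of i at k: the terms below k vanish, and the rest is shifted by k. *)
  rewrite [RHS]big_mkcond [RHS](big_cat_nat (n := k))//=; last first.
    exact: (ltnW (ltn_ord k)).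
  rewrite [X in _ = X + _]big_nat [X in _ = X + _]big1 ?add0r; last first.
    by move=> i /=; rewrite ltnNge => /negbTE ->.
  rewrite -{4}[k : nat]add0n big_addn; apply: eq_bigr => j _.
  by rewrite leq_addl addnK addnC; ring.
rewrite (exchange_big_dep xpredT)//=; apply: eq_bigr => i _.
rewrite mulr_suml (big_ord_widen m (fun k => w (i - k)%N * G k * D i))//.
Qed.

Lemma summation_by_parts (F L : nat -> R) m :
  \sum_(i < m) L i * - (F i.+1 - F i) =
  (F 0%N * L 0%N - F m * L m) + \sum_(i < m) F i.+1 * (L i.+1 - L i).
Proof.
elim: m => [|m IHm]; first by rewrite !big_ord0; ring.
by rewrite !big_ord_recr/= IHm; ring.
Qed.

End DiscreteSums.

Theorem theorem34 (R : realType) (alpha a b : R) (f g : R -> R)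
  (alpha_gt0 : 0 < alpha) (alpha_lt1 : alpha < 1)
  (ab : a < b) (ab_mod1 : b - a \is a Num.int) :
  step_sum (a + 1) (b - 1) (fun s => g s * nabla_right_Caputo b alpha f s)
  = eval_between (fun s => f s * nabla_left_sum a (1 - alpha) g s) b (a + 1)
    + step_sum (a + 1) (b - 1)
        (fun s => f (s + 1) * nabla_left_RL a alpha g (s + 1))
  /\ nabla_left_sum a (1 - alpha) g (a + 1) = g (a + 1).
Proof.
have beta01 : 0 < 1 - alpha <= 1 by apply/andP; split; lra.
split; last first.
  have := nabla_left_sum_nat a (1 - alpha) g 0.
  by rewrite !addr0 big_ord_recl big_ord0 subnn nabla_kernel0// !addr0 mul1r.
(* Here m = b - a - 1, the number of lattice points from a + 1 to b - 1; b - a is a positive natural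
   number, hence a successor. *)
have [m bE] : exists m : nat, b = a + 1 + m%:R.
  have ba0 : 0 < b - a by rewrite subr_gt0.
  have /natrP[[|m] ban] : b - a \is a Num.nat by rewrite natrEint ab_mod1 ltW.
    by rewrite ban ltxx in ba0.
  by exists m; move: ban; rewrite -natr1 => ban; lra.
have step k : a + 1 + k%:R + 1 = a + 1 + k.+1%:R by rewrite -natr1; ring.
have ba : b - 1 - (a + 1) + 1 = m%:R by rewrite bE; ring.
rewrite !(@step_sum_nat _ _ _ _ m)// /eval_between.
pose L k := nabla_left_sum a (1 - alpha) g (a + 1 + k%:R).
pose F k := f (a + 1 + k%:R).
transitivity (\sum_(i < m) L i * - (F i.+1 - F i)).
  under [RHS]eq_bigr do rewrite /L nabla_left_sum_nat.
  rewrite -(sum_convolution_exchange (nabla_kernel (1 - alpha))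
    (fun k => g (a + 1 + k%:R)) (fun k => - (F k.+1 - F k))).
  apply: eq_bigr => k _; congr (_ * _); rewrite /nabla_right_Caputo.
  (* Seen from the point a + 1 + k, the endpoint b lies m - k steps ahead. *)
  have -> : b = a + 1 + k%:R + (m - k)%:R.
    by rewrite natrB ?bE ?(ltnW (ltn_ord k))//; ring.
  rewrite nabla_right_sum_nat; apply: eq_bigr => j _; congr (_ * - _).
  by rewrite /Delta -[_ + _ + j%:R]addrA -natrD step.
rewrite summation_by_parts; congr (_ + _).
  by rewrite /F /L bE addr0.
(* The backward difference at s + 1 is the forward difference at s, that is L(k + 1) - L(k). *)
apply: eq_bigr => k _; rewrite step /nabla_left_RL /nabla -step addrK.
by rewrite step.
Qed.
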